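(* Consider the following algorithm for the $\mathcal{H}$-packing matroid secretary problem on $\mathcal{M}(R,G,\mathcal{H})$: set $\mathrm{ALG}\gets\emptyset$, $\mathcal{Q}\gets\emptyset$, draw $s\sim\mathrm{Bin}(n,p)$; for $i=s+1,\dots,n$: if $r_i\in\mathrm{OPT}(R_i)$ and $r_i$ is already covered by $\mathcal{Q}$, set $\mathrm{ALG}\gets\mathrm{ALG}+r_i$; else if $r_i\in\mathrm{OPT}(R_i)$ and $\mathcal{Q}\cup\{\mathcal{Q}_{\mathrm{OPT}(R_i)}(r_i)\}$ is an $\mathcal{H}$-packing, set $\mathrm{ALG}\gets\mathrm{ALG}+r_i$ and $\mathcal{Q}\gets\mathcal{Q}\cup\{\mathcal{Q}_{\mathrm{OPT}(R_i)}(r_i)\}$; return $\mathrm{ALG}$. This algorithm has forbidden sets of size equal to the exchangeability $\mu$. If $\mu$ is known beforehand and $p=p(\mu)$, it is $\alpha(\mu)$ probability-competitive.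
   Context: Graph packings: $\mathcal{H}$ is a finite set of graphs. An $\mathcal{H}$-packing of a graph $G=(V,E)$ is a collection of node-disjoint subgraphs of $G$, each isomorphic to a graph in $\mathcal{H}$; a vertex is covered if it lies in one of them. For $R\subseteq V$, $\mathcal{M}(R,G,\mathcal{H})$ is the set system on $R$ whose independent sets are the $X\subseteq R$ covered by some $\mathcal{H}$-packing; $\mathcal{H}$ is matroidal if $\mathcal{M}(V(G),G,\mathcal{H})$ is a matroid for every graph $G$ (then $\mathcal{M}(R,G,\mathcal{H})$ is a matroid). Here $\mathcal{H}$ is matroidal, $R$ is the set of terminals, $|R|=n$. For every independent $X$ a canonical $\mathcal{H}$-packing $\mathcal{Q}_X$ covering $X$ is fixed, independent of the arrival order; $\mathcal{Q}(v)$ denotes the graph of $\mathcal{Q}$ covering $v$. Exchangeability: $\mu=\max\sum_{H'\in\mathcal{Q}: V(H)\cap V(H')\ne\emptyset}|V(H')\cap R|$, over $\mathcal{H}$-packings $\mathcal{Q}$ of $G$ and subgraphs $H\subseteq G$ isomorphic to a member of $\mathcal{H}$ covering a terminal not covered by $\mathcal{Q}$. Ordinal MSP setting: total order $\succ$ on $R$; $\mathrm{OPT}(Q)$ is the greedy (lexicographically maximum w.r.t. $\succ$) base of $Q\subseteq R$, $\mathrm{OPT}=\mathrm{OPT}(R)$; terminals arrive in uniformly random order $r_1,\dots,r_n$, $R_t=\{r_1,\dots,r_t\}$. Probability-competitive: $\Pr(e\in\mathrm{ALG})\ge1/\alpha$ for all $e\in\mathrm{OPT}$. Forbidden sets of size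 $k$: (1) output always independent; (2) draws $s\sim\mathrm{Bin}(n,p)$ and accepts none of the first $s$ elements; (3) for every $(X,Y,r^* )$ with $Y\subseteq R$, $r^*\in\mathrm{OPT}(Y)$, $X\subseteq Y\setminus\{r^*\}$ there is $\mathcal{F}(X,Y,r^* )\subseteq X$ with at most $k$ elements such that for every $t\ge s+1$, if $r_t\in\mathrm{OPT}(R_t)$ and $r_j\notin\mathcal{F}(R_j,R_t,r_t)$ for all $j\in\{s+1,\dots,t-1\}$ then $r_t$ is selected. $(p(1),\alpha(1))=(1/e,e)$; for $k\ge2$, $(p(k),\alpha(k))=(k^{-1/(k-1)},k^{k/(k-1)})$. *)

(* Defs.v *)
From HB Require Import structures.
From mathcomp Require Import all_boot all_order all_algebra.
Set Implicit Arguments.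
Unset Strict Implicit.
Unset Printing Implicit Defensive.

(* Finite simple undirected graphs. *)
Record sgraph := SGraph {
  vertices :> finType;
  adj : rel vertices;
  adj_sym : symmetric adj;
  adj_irr : irreflexive adj }.

Section Subgraphs.
Variable G : sgraph.

(* A candidate subgraph: a vertex set and an edge set, edges being two-element
   vertex sets.  Subgraphs need not be induced. *)
Definition subgraph_data : finType := ({set G} * {set {set G}})%type.

Definition edge_set : {set {set G}} :=
  [set e : {set G} | [exists x, exists y, adj x y && (e == [set x; y])]].

Definition is_subgraph (S : subgraph_data) : bool :=
  (S.2 \subset edge_set) && [forall e in S.2, e \subset S.1].

Definition isomorphic (H : sgraph) (S : subgraph_data) : bool :=
  [exists f : {ffun H -> G},
    [&& injectiveb f, f @: [set: H] == S.1 &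
        [forall x : H, forall y : H, adj x y == ([set f x; f y] \in S.2)]]].

Variable HH : seq sgraph.

Definition is_copy (S : subgraph_data) : bool :=
  is_subgraph S && has (fun H => isomorphic H S) HH.

Definition is_packing (P : {set subgraph_data}) : bool :=
  [forall S in P, is_copy S] &&
  [forall S in P, forall S' in P, (S != S') ==> [disjoint S.1 & S'.1]].

Definition covered (P : {set subgraph_data}) : {set G} := \bigcup_(S in P) S.1.

(* The system M(T, G, HH). *)
Definition packing_indep (T X : {set G}) : bool :=
  (X \subset T) &&
  [exists P : {set subgraph_data}, is_packing P && (X \subset covered P)].

(* The graph of P covering v, if there is one; unique when P is a packing. *)
Definition graph_covering (P : {set subgraph_data}) (v : G) :
    option subgraph_data :=
  [pick S in P | v \in S.1].

(* The maximum over the empty set is read as 0. *)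
Definition exchangeability (T : {set G}) : nat :=
  \max_(PS : {set subgraph_data} * subgraph_data |
        [&& is_packing PS.1, is_copy PS.2 &
            [exists v in T, (v \in PS.2.1) && (v \notin covered PS.1)]])
    \sum_(S' in PS.1 | ~~ [disjoint PS.2.1 & S'.1]) #|S'.1 :&: T|.

Definition canonical_packings (T : {set G})
    (Qc : {set G} -> {set subgraph_data}) : Prop :=
  forall X : {set G}, packing_indep T X ->
    is_packing (Qc X) && (X \subset covered (Qc X)).

End Subgraphs.

Definition is_matroid (V : finType) (E : {set V}) (I : pred {set V}) : Prop :=
  [/\ forall X : {set V}, I X -> X \subset E,
      I set0,
      forall X Y : {set V}, X \subset Y -> I Y -> I X &
      forall X Y : {set V}, I X -> I Y -> #|X| < #|Y| ->
        exists2 y, y \in Y :\: X & I (y |: X)].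

Definition matroidal (HH : seq sgraph) : Prop :=
  forall G : sgraph, is_matroid [set: G] (packing_indep HH [set: G]).

Section OrdinalMSP.
Variables (V : finType) (R : {set V}).
(* Independence on R, and the strict order: [gtR x y] means x is preferred
   to y. *)
Variables (I : pred {set V}) (gtR : rel V).

Definition strict_total_order_on : Prop :=
  [/\ {in R, forall x, ~~ gtR x x},
      {in R & &, forall x y z, gtR x y -> gtR y z -> gtR x z} &
      {in R &, forall x y, x != y -> gtR x y || gtR y x}].

(* Greedy base: scan Q from best to worst, keeping an element whenever
   independence is preserved. *)
Definition OPT (Q : {set V}) : {set V} :=
  foldl (fun B x => if I (x |: B) then x |: B else B) set0
    (sort (fun x y => (x == y) || gtR x y) (enum Q)).

(* Arrival orders are indexed from 0: [tnth r i] is the terminal r_(i+1). *)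
Definition arrival_orders : {set #|R|.-tuple V} :=
  [set r : #|R|.-tuple V | perm_eq r (enum R)].

(* The set of terminals arrived up to and including [tnth r i]. *)
Definition arrived (r : #|R|.-tuple V) (i : 'I_#|R|) : {set V} :=
  [set tnth r j | j : 'I_#|R| & j <= i].

End OrdinalMSP.

Section PackingAlgorithm.
Variables (HH : seq sgraph) (G : sgraph) (T : {set G}) (gtR : rel G).
Variable Qc : {set G} -> {set subgraph_data G}.

Definition packing_step (r : #|T|.-tuple G)
    (st : {set G} * {set subgraph_data G}) (i : 'I_#|T|) :
    {set G} * {set subgraph_data G} :=
  let: (A, Q) := st in
  let x := tnth r i in
  let O := OPT (packing_indep HH T) gtR (arrived r i) in
  if x \in O then
    if x \in covered Q then (x |: A, Q)
    else match graph_covering (Qc O) x with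
         | Some C => if is_packing HH (C |: Q) then (x |: A, C |: Q) else st
         | None => st (* impossible for canonical packings *)
         end
  else st.

Definition packing_run (s : nat) (r : #|T|.-tuple G) : {set G} :=
  (foldl (packing_step r) (set0, set0)
     [seq i : 'I_#|T| <- enum 'I_#|T| | s <= i]).1.

End PackingAlgorithm.

From mathcomp Require Import all_classical all_reals all_analysis.
Import Order.TTheory GRing.Theory Num.Theory.
Local Open Scope ring_scope.

(* A secretary algorithm whose internal randomness is its sample size. *)
Record secretary_alg (K : realType) (V : finType) (R : {set V}) := SecretaryAlg {
  sample_law : probability nat K;
  run : nat -> #|R|.-tuple V -> {set V} }.

Section SecretaryProperties.
Variables (K : realType) (V : finType) (R : {set V}).
Variables (I : pred {set V}) (gtR : rel V).

(* The arrival order is uniform and independent of the sample size. *)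
Definition prob_selected (A : secretary_alg K R) (e : V) : K :=
  (\sum_(r in arrival_orders R)
     fine (sample_law A [set s | e \in run A s r]%classic))
  / #|arrival_orders R|%:R.

Definition probability_competitive (alpha : K) (A : secretary_alg K R) : Prop :=
  forall e, e \in OPT I gtR R -> alpha^-1 <= prob_selected A e.

Definition has_forbidden_sets (k : nat) (p : K) (A : secretary_alg K R) : Prop :=
  [/\ forall s r, (s <= #|R|)%N -> r \in arrival_orders R -> I (run A s r),
      (forall U : set nat, sample_law A U = binomial_prob #|R| p U) /\
      (forall s r (i : 'I_#|R|), (s <= #|R|)%N -> r \in arrival_orders R ->
         (i < s)%N -> tnth r i \notin run A s r) &
      exists F : {set V} -> {set V} -> V -> {set V},
        (forall (X Y : {set V}) (x : V),
           Y \subset R -> x \in OPT I gtR Y -> X \subset Y :\ x ->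
           (F X Y x \subset X) /\ (#|F X Y x| <= k)%N) /\
        (forall s r (t : 'I_#|R|), r \in arrival_orders R -> (s <= t)%N ->
           tnth r t \in OPT I gtR (arrived r t) ->
           (forall j : 'I_#|R|, (s <= j < t)%N ->
              tnth r j \notin F (arrived r j) (arrived r t) (tnth r t)) ->
           tnth r t \in run A s r)].

End SecretaryProperties.

Definition packing_alg (K : realType) (HH : seq sgraph) (G : sgraph)
    (T : {set G}) (gtR : rel G) (Qc : {set G} -> {set subgraph_data G})
    (p : K) : secretary_alg K T :=
  {| sample_law := binomial_prob #|T| p;
     run := packing_run HH gtR Qc |}.

(* The constants are meant for k >= 1; at k = 0 the formulas for k >= 2
   evaluate to the degenerate pair (0, 1). *)
Definition p_of (K : realType) (k : nat) : K :=
  if k == 1%N then (expR 1)^-1 else k%:R `^ (- (1 / (k%:R - 1))).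

Definition alpha_of (K : realType) (k : nat) : K :=
  if k == 1%N then expR 1 else k%:R `^ (k%:R / (k%:R - 1)).

(* Main.v *)
(* Reveal the arrival order backwards.  Given the set of the first j terminals,
   the j-th one is uniform in it, hence is forbidden with probability at most
   k/j.  So if e in OPT arrives last among the first t+1 terminals, no terminal
   at positions s+1, ..., t is forbidden with probability at least
   W(s,t) = prod_(s < j <= t) (1 - k/j), and then e is selected.  With
   a(s) = 1/n sum_(s <= t < n) W(s,t), the probability that e is selected is at
   least g(p) = sum_s C(n,s) p^s (1-p)^(n-s) a(s).  The recursion of a in s gives
   p g'(p) <= k g(p) - p and g(1) = 0, whence
   g(p) >= p^k int_p^1 t^(-k) dt, which is 1/alpha(k) at p = p(k). *)

Require Import Defs.
From mathcomp Require Import all_boot all_order all_algebra.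
From mathcomp Require Import all_classical all_reals all_analysis.
From mathcomp Require Import fintype finset ring lra.
Set Implicit Arguments.
Unset Strict Implicit.
Unset Printing Implicit Defensive.
Import Order.TTheory GRing.Theory Num.Theory.
Import numFieldNormedType.Exports.
Local Open Scope ring_scope.

(** * Greedy bases *)

Section Greedy.
Variables (V : finType) (E : {set V}) (I : pred {set V}).
Hypothesis matI : is_matroid E I.

(** Repeat the augmentation axiom; each added element lowers the gap [#|Y| - #|X|] on which the
    induction runs. *)
Lemma indep_extend (X Y : {set V}) : I X -> I Y ->
  exists Z : {set V},
    [/\ X \subset Z, Z \subset X :|: Y, I Z & (#|Y| <= #|Z|)%N].
Proof.
case: matI => _ _ _ aug.
have [m] := ubnP (#|Y| - #|X|)%N; elim: m X => // m IHm X ltm IX IY.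
have [leYX|ltXY] := leqP #|Y| #|X|; first by exists X; rewrite subsetUl.
have [y /setDP[Yy nXy] IyX] := aug X Y IX IY ltXY.
have cardyX : #|y |: X| = #|X|.+1 by rewrite cardsU1 nXy.
have [|//|//|Z [yXZ ZyXY IZ leYZ]] := IHm (y |: X).
  by rewrite cardyX subnS prednK ?subn_gt0.
exists Z; split=> //; first exact: subset_trans (subsetUr _ _) yXZ.
apply: subset_trans ZyXY _; rewrite -setUA subUset subxx sub1set !inE Yy.
by rewrite !orbT.
Qed.

Definition greedy (l : seq V) : {set V} :=
  foldl (fun B x => if I (x |: B) then x |: B else B) set0 l.

Lemma greedy_rcons l y :
  greedy (rcons l y) = if I (y |: greedy l) then y |: greedy l else greedy l.
Proof. by rewrite /greedy foldl_rcons. Qed.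

Lemma greedy_indep l : I (greedy l).
Proof.
elim/last_ind: l => [|l y IHl]; first by case: matI.
by rewrite greedy_rcons; case: ifP.
Qed.

Lemma sub_greedy_rcons l y : greedy l \subset greedy (rcons l y).
Proof. by rewrite greedy_rcons; case: ifP => // _; apply: subsetUr. Qed.

Lemma mem_greedy l x : x \in greedy l -> x \in l.
Proof.
elim/last_ind: l x => [|l y IHl] x; first by rewrite /greedy /= inE.
rewrite greedy_rcons mem_rcons in_cons; case: ifP => _.
  by case/setU1P=> [->|/IHl->]; rewrite ?eqxx ?orbT.
by move/IHl->; rewrite orbT.
Qed.

(** If [x] is compatible with the final greedy set, then by heredity it was compatible with the
    smaller set held when [x] was scanned, so it was kept. *)
Lemma greedy_maximal l x : x \in l -> I (x |: greedy l) -> x \in greedy l.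
Proof.
have hered : forall X Y : {set V}, X \subset Y -> I Y -> I X by case: matI.
elim/last_ind: l => [|l y IHl] //.
rewrite mem_rcons in_cons => /predU1P[->|xl] IxG.
  rewrite greedy_rcons (hered _ _ _ IxG) ?setU11 //.
  exact/setUS/sub_greedy_rcons.
apply: (subsetP (sub_greedy_rcons l y)); apply: IHl => //.
exact: hered (setUS _ (sub_greedy_rcons l y)) IxG.
Qed.

Lemma card_indep_greedy (X : {set V}) l :
  I X -> {subset X <= l} -> (#|X| <= #|greedy l|)%N.
Proof.
case: matI => _ _ _ aug IX Xl; rewrite leqNgt; apply/negP => ltGX.
have [y /setDP[Xy nGy] IyG] := aug _ _ (greedy_indep l) IX ltGX.
by case/negP: nGy; apply: greedy_maximal => //; apply: Xl.
Qed.

(* Extend the greedy set of the sublist inside x |: greedy l up to the size of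
   the latter: by maximality of greedy l the extension must use x. *)
Lemma greedy_filter (P : pred V) l x :
  uniq l -> P x -> x \in greedy l -> x \in greedy [seq y <- l | P y].
Proof.
have hered : forall X Y : {set V}, X \subset Y -> I Y -> I X by case: matI.
move=> + Px; elim/last_ind: l => [|l y IHl] //.
rewrite rcons_uniq => /andP[nly Ul] Gx; rewrite filter_rcons.
have [eqxy|neqxy] := eqVneq x y; last first.
  have Glx : x \in greedy l.
    move: Gx; rewrite greedy_rcons; case: ifP => // _.
    by rewrite in_setU1 (negPf neqxy).
  case: ifP => _; last exact: IHl.
  exact: subsetP (sub_greedy_rcons _ _) _ (IHl Ul Glx).
rewrite -{y}eqxy in nly Gx *; rewrite Px greedy_rcons.
have nGlx : x \notin greedy l by apply: contra nly; apply: mem_greedy.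
have IxG : I (x |: greedy l).
  by move: Gx; rewrite greedy_rcons; case: ifP => // _ Gx; case/negP: nGlx.
suff -> : I (x |: greedy [seq y <- l | P y]) by rewrite setU11.
have [Z [GZ ZU IZ leZ]] := indep_extend (greedy_indep [seq y <- l | P y]) IxG.
have Zx : x \in Z.
  apply/negPn/negP => nZx; rewrite cardsU1 nGlx add1n in leZ.
  suff /(card_indep_greedy IZ)/(leq_trans leZ) : {subset Z <= l}.
    by rewrite ltnn.
  move=> z Zz; have := subsetP ZU z Zz.
  rewrite !inE => /or3P[/mem_greedy|/eqP zx|/mem_greedy//].
    by rewrite mem_filter => /andP[].
  by rewrite -zx Zz in nZx.
by apply: hered IZ; rewrite subUset sub1set Zx.
Qed.

Variable gtR : rel V.
Hypothesis ordR : strict_total_order_on E gtR.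

Lemma OPT_indep Q : I (OPT I gtR Q). Proof. exact: greedy_indep. Qed.

Lemma OPT_sub Q : OPT I gtR Q \subset Q.
Proof.
by apply/subsetP => x /mem_greedy; rewrite mem_sort mem_enum.
Qed.

(** Filtering commutes with sorting, which reduces this to [greedy_filter]. It keeps a terminal of
    the global optimum optimal in every arrived set that contains it. *)
Lemma OPT_restrict (X Y : {set V}) x :
  X \subset Y -> Y \subset E -> x \in X ->
  x \in OPT I gtR Y -> x \in OPT I gtR X.
Proof.
move=> XY /subsetP YE Xx Yx; set le := fun x y => (x == y) || gtR x y.
have [_ trR totR] := ordR.
have le_tot : {in E &, total le}.
  move=> y z Ey Ez; rewrite /le /=; have [//|neq] := eqVneq y z.
  exact: totR.
have le_tr : {in E & &, transitive le}.
  move=> z y t Ez Ey Et; rewrite /le /= => /predU1P[->//|yz].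
  case/predU1P => [<-|zt]; first by rewrite yz orbT.
  by rewrite (trR y z t) ?orbT.
(* The order is total and transitive only on [E], hence the relativized form of the commutation. *)
have -> : OPT I gtR X = greedy [seq y <- sort le (enum Y) | y \in X].
  rewrite (filter_sort_in le_tot le_tr); last first.
    by apply/allP => y; rewrite mem_enum => /YE.
  congr foldl; congr sort; rewrite /enum_mem -filter_predI.
  apply: eq_filter => y /=.
  by case: (boolP (y \in X)) => // /(subsetP XY)->.
by apply: greedy_filter => //; rewrite sort_uniq enum_uniq.
Qed.

End Greedy.

(** * Counting arrival orders *)

Section CountingOrders.
Variable V : finType.
Implicit Types (X Y : {set V}) (w : seq V) (P : pred (seq V)).

Lemma perm_enumP w Y :
  reflect (uniq w /\ w =i Y) (perm_eq w (enum Y)).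
Proof.
apply: (iffP idP) => [wY|[Uw wY]].
  rewrite (perm_uniq wY) enum_uniq; split=> // x.
  by rewrite (perm_mem wY) mem_enum.
by apply: uniq_perm => [||x]; rewrite ?enum_uniq // mem_enum wY.
Qed.

Lemma perm_enum_size w Y : perm_eq w (enum Y) -> size w = #|Y|.
Proof. by move/perm_size->; rewrite cardE. Qed.

Lemma perm_enum_set_rcons w Y x :
  x \in Y -> perm_eq w (enum (Y :\ x)) -> [set y in rcons w x] = Y.
Proof.
move=> Yx /perm_enumP[_ wY]; apply/setP => y.
rewrite inE mem_rcons in_cons wY !inE.
by have [->|] := eqVneq y x.
Qed.

Definition nb_orders P Y : nat := count P (permutations (enum Y)).

Lemma eq_nb_orders P P' Y :
    (forall w, perm_eq w (enum Y) -> P w = P' w) ->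
  nb_orders P Y = nb_orders P' Y.
Proof.
by move=> PP'; apply: eq_in_count => w; rewrite mem_permutations => /PP'.
Qed.

Lemma nb_orders0 P : nb_orders P set0 = P [::].
Proof. by rewrite /nb_orders enum_set0 /= addn0. Qed.

(** Each order of [Y] is, in one way only, an order of [Y :\ x] followed by some [x]. In terms of
    counts, this reveals the arrival order backwards. *)
Lemma nb_orders_last P Y : Y != set0 ->
  nb_orders P Y = (\sum_(x in Y) nb_orders (fun w => P (rcons w x)) (Y :\ x))%N.
Proof.
move=> Y0; pose f x w := rcons w x : seq V.
have permY : perm_eq (permutations (enum Y))
    [seq f x w | x <- enum Y, w <- permutations (enum (Y :\ x))].
  apply: uniq_perm => [||w]; first exact: permutations_uniq.
    apply: allpairs_uniq_dep; first exact: enum_uniq.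
      by move=> x _; apply: permutations_uniq.
    by move=> [x u] [y v] _ _ /= /rcons_inj[-> ->].
  rewrite mem_permutations; apply/perm_enumP/allpairsPdep.
    case: (lastP w) => [|u x] [Uw wY].
      by case/set0Pn: Y0 => x; rewrite -wY.
    move: Uw; rewrite rcons_uniq => /andP[nux Uu].
    exists x, u; split=> //; first by rewrite mem_enum -wY mem_rcons mem_head.
    rewrite mem_permutations; apply/perm_enumP; split=> // y.
    rewrite !inE -wY mem_rcons in_cons.
    by have [->|] := eqVneq y x; first exact: negPf.
  case=> x [u []]; rewrite mem_enum mem_permutations => Yx.
  case/perm_enumP => Uu uY ->; split; first by rewrite rcons_uniq uY !inE eqxx.
  move=> y; rewrite mem_rcons in_cons uY !inE.
  by have [->|] := eqVneq y x.
rewrite /nb_orders (permP permY) count_flatten sumnE !big_map big_enum /=.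
by apply: eq_bigr => x _; rewrite count_map.
Qed.

Variable x0 : V.

(** Positions count from 0, so the element at position [j] is tested against the set of the first
    [j.+1] elements, itself included. Here [x0] is the default of [nth]; in [unobstructed] it is the
    terminal being followed. *)
Definition avoids (s : nat) (b : {set V} -> {set V}) : pred (seq V) := fun w =>
  all (fun j => nth x0 w j \notin b [set x in take j.+1 w])
      (index_iota s (size w)).

Lemma avoids_rcons s b w x :
  avoids s b (rcons w x) =
  avoids s b w && ((s <= size w)%N ==> (x \notin b [set y in rcons w x])).
Proof.
have eq_avoids : all (fun j => nth x0 (rcons w x) j \notin
    b [set y in take j.+1 (rcons w x)]) (index_iota s (size w)) = avoids s b w.
  apply: eq_in_all => j; rewrite mem_index_iota => /andP[_ ltjw].
  by rewrite nth_rcons ltjw -cats1 takel_cat.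
rewrite -eq_avoids {1}/avoids size_rcons.
rewrite /index_iota; have [lesw|ltws] := leqP s (size w).
  rewrite subSn // -addn1 iotaD all_cat subnKC //= nth_rcons ltnn eqxx andbT.
  by rewrite take_oversize ?size_rcons.
have /eqP-> : ((size w).+1 - s == 0)%N by rewrite subn_eq0.
by have /eqP-> : (size w - s == 0)%N by rewrite subn_eq0 ltnW.
Qed.

Variables (K : realType) (k : nat).

(* The subtraction is truncated, so survival s t = 0 if s < t and s < k. *)
Definition survival (s t : nat) : K :=
  \prod_(s <= j < t) ((j.+1 - k)%:R / j.+1%:R).

Lemma survival_ge0 s t : 0 <= survival s t.
Proof. by apply: prodr_ge0 => j _; rewrite divr_ge0 ?ler0n. Qed.

(* At least j - k of the j possible values of the j-th element are allowed. *)
Lemma nb_orders_avoids s (b : {set V} -> {set V}) Y :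
    (forall X : {set V}, X \subset Y -> (#|b X| <= k)%N) ->
  (#|Y|)`!%:R * survival s #|Y| <= (nb_orders (avoids s b) Y)%:R.
Proof.
have [m] : exists m, #|Y| = m by exists #|Y|.
elim: m Y => [|m IHm] Y cardY bk; rewrite cardY.
  move/eqP: cardY; rewrite cards_eq0 => /eqP->.
  by rewrite nb_orders0 /survival big_geq // mulr1.
have card_last x : x \in Y -> #|Y :\ x| = m.
  by move=> Yx; move: cardY; rewrite (cardsD1 x) Yx => -[].
have IH x : x \in Y ->
    m`!%:R * survival s m <= (nb_orders (avoids s b) (Y :\ x))%:R :> K.
  move=> Yx; rewrite -{1 2}(card_last x Yx); apply: IHm; first exact: card_last.
  by move=> X /subset_trans sXY; apply/bk/sXY/subD1set.
rewrite nb_orders_last -?cards_eq0 ?cardY // natr_sum.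
(* The test on the last element depends on the set [Y] alone, so it factors out of the count over
   orders of the rest. *)
have step x : x \in Y -> nb_orders (fun w => avoids s b (rcons w x)) (Y :\ x) =
    (((s <= m)%N ==> (x \notin b Y)) * nb_orders (avoids s b) (Y :\ x))%N.
  move=> Yx; case: (boolP (_ ==> _)) => sx; rewrite ?mul1n ?mul0n.
    apply: eq_nb_orders => w wY.
    rewrite avoids_rcons (perm_enum_size wY) card_last //.
    by rewrite (perm_enum_set_rcons Yx) // sx andbT.
  rewrite -[RHS](count_pred0 (permutations (enum (Y :\ x)))).
  apply: eq_nb_orders => w wY.
  rewrite avoids_rcons (perm_enum_size wY) card_last //.
  by rewrite (perm_enum_set_rcons Yx) // (negPf sx) andbF.
rewrite (eq_bigr (fun x => ((s <= m)%N ==> (x \notin b Y))%:R *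
  (nb_orders (avoids s b) (Y :\ x))%:R)); last first.
  by move=> x /step->; rewrite natrM.
have m0 : (m.+1%:R : K) != 0 by rewrite pnatr_eq0.
(* For [m < s] the last element falls in the sample: it is not tested, and the survival products are
   empty. *)
have [lesm|ltms] := leqP s m; last first.
  rewrite /survival big_geq // mulr1 factS natrM.
  apply: le_trans (_ : \sum_(x in Y) m`!%:R <= _).
    by rewrite sumr_const cardY -[X in _ <= X]mulr_natl.
  apply: ler_sum => x Yx; rewrite mul1r; apply: le_trans (IH x Yx).
  by rewrite /survival big_geq ?mulr1 // ltnW.
rewrite /survival big_nat_recr //= -/(survival s m).
apply: le_trans (_ : \sum_(x in Y :\: b Y) m`!%:R * survival s m <= _).
  rewrite sumr_const -[X in _ <= X]mulr_natl factS natrM.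
  rewrite [X in X <= _](_ : _ = (m.+1 - k)%:R * (m`!%:R * survival s m)).
    2: by field; rewrite -?natr1 ?natr1 ?m0.
  apply: ler_wpM2r; first by rewrite mulr_ge0 ?survival_ge0.
  rewrite ler_nat cardsD cardY; apply: leq_sub2l.
  by apply: leq_trans (bk Y _) => //; apply/subset_leq_card/subsetIr.
rewrite [X in _ <= X](bigID (fun x => x \in b Y)) /= addrC.
rewrite -[X in X <= _]addr0; apply: lerD; last first.
  by apply: sumr_ge0 => x _; rewrite mulr_ge0 ?ler0n.
rewrite [X in X <= _](eq_bigl (fun x => (x \in Y) && (x \notin b Y))).
  2: by move=> x; rewrite inE andbC.
by apply: ler_sum => x /andP[Yx ->]; rewrite mul1r; apply: IH.
Qed.

Variables (s : nat) (b : {set V} -> {set V} -> {set V}).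

(** The second argument of [b] is the prefix ending in [x0], because a forbidden set may depend on
    everything present when [x0] arrives. *)
Definition unobstructed : pred (seq V) := fun w =>
  let i := index x0 w in
  (s <= i < size w)%N &&
  avoids s (fun X => b X [set x in take i.+1 w]) (take i w).

Lemma unobstructed_rcons w x : x0 \in w ->
  unobstructed (rcons w x) = unobstructed w.
Proof.
move=> wx0; rewrite /unobstructed size_rcons -cats1 index_cat wx0.
have ltiw : (index x0 w < size w)%N by rewrite index_mem.
by rewrite ltiw leqW // !takel_cat // ltnW.
Qed.

Lemma unobstructed_last w : x0 \notin w ->
  unobstructed (rcons w x0) =
  (s <= size w)%N && avoids s (fun X => b X [set x in rcons w x0]) w.
Proof.
move=> nwx0; rewrite /unobstructed size_rcons -cats1 index_cat (negPf nwx0) /=.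
rewrite eqxx addn0 ltnSn andbT (take_size_cat _ (erefl _)).
by rewrite take_oversize // cats1 size_rcons.
Qed.

(** The sum runs over the position [t] of [x0]. Peel off the last element: if it is [x0],
    [nb_orders_avoids] gives the term of the last position; otherwise it has no effect on [x0], and
    the induction hypothesis gives the earlier positions. *)
Lemma nb_orders_unobstructed Y : x0 \in Y ->
    (forall X Z : {set V}, x0 \in Z -> Z \subset Y -> X \subset Z :\ x0 ->
      (#|b X Z| <= k)%N) ->
  (#|Y|.-1)`!%:R * (\sum_(s <= t < #|Y|) survival s t) <=
    (nb_orders unobstructed Y)%:R.
Proof.
have [m] : exists m, #|Y| = m by exists #|Y|.
elim: m Y => [|m IHm] Y cardY Yx0 bk.
  by move/eqP: cardY; rewrite cards_eq0 => /eqP Y0; rewrite Y0 inE in Yx0.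
have card_last x : x \in Y -> #|Y :\ x| = m.
  by move=> Yx; move: cardY; rewrite (cardsD1 x) Yx => -[].
rewrite cardY nb_orders_last -?cards_eq0 ?cardY // (big_setD1 x0) //=.
rewrite natrD natr_sum addrC.
have last_le : (s <= m)%N -> m`!%:R * survival s m <=
    (nb_orders (fun w => unobstructed (rcons w x0)) (Y :\ x0))%:R.
  move=> lesm; rewrite (eq_nb_orders (P' := avoids s (b ^~ Y))).
    rewrite -{1 2}(card_last x0) //; apply: nb_orders_avoids => X sX.
    exact: bk.
  move=> w wY; have [_ wY'] := perm_enumP _ _ wY.
  rewrite unobstructed_last ?wY' ?inE ?eqxx // (perm_enum_size wY).
  by rewrite card_last // lesm (perm_enum_set_rcons Yx0).
have rest_le : m`!%:R * (\sum_(s <= t < m) survival s t) <=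
    \sum_(x in Y :\ x0)
      (nb_orders (fun w => unobstructed (rcons w x)) (Y :\ x))%:R.
  case: m => [|m] in IHm cardY card_last last_le *.
    by rewrite big_geq // mulr0 sumr_ge0.
  apply: le_trans (_ : \sum_(x in Y :\ x0)
    (m`!%:R * (\sum_(s <= t < m.+1) survival s t)) <= _).
    by rewrite sumr_const card_last // factS natrM -mulrA mulr_natl.
  apply: ler_sum => x /setD1P[neqx Yx].
  have Yxx0 : x0 \in Y :\ x by rewrite !inE eq_sym neqx.
  rewrite (eq_nb_orders (P' := unobstructed)); last first.
    by move=> w /perm_enumP[_ wY]; rewrite unobstructed_rcons ?wY.
  have := IHm (Y :\ x); rewrite card_last //; apply=> // X Z Zx0 ZY.
  exact/bk/(subset_trans ZY)/subD1set.
have [lesm|ltms] := leqP s m; last first.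
  by rewrite big_geq // mulr0 addr_ge0 // sumr_ge0.
by rewrite big_nat_recr //= mulrDr lerD // last_le.
Qed.

End CountingOrders.

(** * A differential inequality for Bernstein sums *)

Section Analysis.
Variable K : realType.
Implicit Types (p x : K) (k n s : nat).

(* f x * x `^ (- k) is nonincreasing. *)
Lemma ge0_of_derive_le (f df : K -> K) k p : 0 < p <= 1 ->
    (forall x, 0 < x -> is_derive x 1 f (df x)) ->
    (forall x, 0 < x <= 1 -> x * df x <= k%:R * f x) ->
  0 <= f 1 -> 0 <= f p.
Proof.
move=> /andP[p0 p1] fD f_le f1; pose a : K := - k%:R.
pose h x := f x * x `^ a; pose dh x := f x * (a * x `^ (a - 1)) + x `^ a * df x.
have hD x : 0 < x -> is_derive x 1 h (dh x).
  move=> x0; have fDx := fD x x0; have pDx := is_derive1_powR a x0.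
  exact: is_deriveM.
have [c] : exists2 c, c \in `[p, 1] & h 1 - h p = dh c * (1 - p).
  apply: MVT_segment => // [x|].
    by rewrite in_itv /= => /andP[px _]; apply/hD/(lt_trans p0).
  apply: derivable_within_continuous => x; rewrite in_itv /= => /andP[px _].
  by have /@ex_derive := hD x (lt_le_trans p0 px).
rewrite in_itv /= => /andP[pc c1] hE.
have c0 : 0 < c := lt_le_trans p0 pc.
have dhc : dh c <= 0.
  (* The product rule gives h'(c) = c^(-k-1) (c f'(c) - k f(c)), whose sign is known from [f_le]. *)
  have -> : dh c = c `^ (a - 1) * (c * df c - k%:R * f c).
    rewrite /dh; have -> : c `^ a = c `^ (a - 1) * c.
      by rewrite -{3}(powRr1 (ltW c0)) -powRD ?subrK // (gt_eqF c0) implybT.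
    by rewrite /a; ring.
  by rewrite mulr_ge0_le0 ?powR_ge0 // subr_le0 f_le // c0.
have : h 1 <= h p by rewrite -subr_le0 hE mulr_le0_ge0 // subr_ge0.
rewrite /h powR1 mulr1 => /(le_trans f1).
by rewrite pmulr_lge0 // powR_gt0.
Qed.

Definition bernstein n s : {poly K} :=
  ('X ^+ s * (1 - 'X) ^+ (n - s)) *+ 'C(n, s).

Lemma horner_bernstein n s x : (bernstein n s).[x] = binomial_pmf n x s.
Proof.
by rewrite /bernstein hornerMn hornerM !hornerXn horner_exp !hornerE.
Qed.

(** Differentiating (1-X)^(n-s) brings out (n-s) C(n,s) = (s+1) C(n,s+1), the coefficient of the
    next Bernstein polynomial. *)
Lemma derive_bernstein n s :
  'X * (bernstein n s)^`() = bernstein n s *+ s - bernstein n s.+1 *+ s.+1.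
Proof.
have derivX1 : 'X * ('X^s)^`() = 'X^s *+ s :> {poly K}.
  by rewrite derivXn mulrnAr; case: s => [|s]; rewrite ?mulr0n // -exprS.
have deriv1X m : ((1 - 'X) ^+ m)^`() = - (1 - 'X) ^+ m.-1 *+ m :> {poly K}.
  by rewrite deriv_exp derivB derivC derivX sub0r mulNr mul1r.
rewrite /bernstein derivMn derivM deriv1X mulrnAr mulrDr mulrA derivX1 mulrA.
rewrite -exprS mulrnAr mulrN mulrnAl mulrnDl mulNrn mulNrn subnS -!mulrnA.
by rewrite -mul_bin_left mulnC [('C(n, s.+1) * _)%N]mulnC.
Qed.

(** Summation by parts: the derivative acts through the differences of [a], which [sample_gain_step]
    controls for the sample gain. *)
Lemma horner_deriv_bernstein_sum n (a : nat -> K) x :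
  x * (\sum_(s < n.+1) a s *: bernstein n s)^`().[x] =
  \sum_(s < n) s.+1%:R * (a s.+1 - a s) * binomial_pmf n x s.+1.
Proof.
have -> : x * (\sum_(s < n.+1) a s *: bernstein n s)^`().[x] =
    \sum_(s < n.+1) a s * (binomial_pmf n x s *+ s) -
    \sum_(s < n.+1) a s * (binomial_pmf n x s.+1 *+ s.+1).
  rewrite -{1}(hornerX x) -hornerM raddf_sum /= mulr_sumr horner_sum -sumrB.
  apply: eq_bigr => s _; rewrite derivZ -scalerAr derive_bernstein hornerZ.
  rewrite hornerD hornerN hornerMn horner_bernstein hornerMn horner_bernstein.
  by rewrite mulrBr.
(* The term s = 0 of the first sum has the factor 0, and the term s = n of the second vanishes
   because C(n,n+1) = 0. *)
rewrite big_ord_recl [X in _ - X]big_ord_recr /= mulr0n mulr0 add0r.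
have -> : binomial_pmf n x n.+1 = 0 by rewrite /binomial_pmf bin_small.
rewrite mul0rn mulr0 addr0 -sumrB.
apply: eq_bigr => s _; rewrite /bump /= add1n.
by rewrite -mulrBl mulrnAr -mulrnAl mulr_natl.
Qed.

Lemma sum_binomial_pmf n x : \sum_(s < n.+1) binomial_pmf n x s = 1.
Proof.
have := exprDn (1 - x) x n; rewrite subrK expr1n => ->.
by apply: eq_bigr => s _; rewrite /binomial_pmf mulrC.
Qed.

Lemma mean_binomial_pmf n x :
  \sum_(s < n) s.+1%:R * binomial_pmf n x s.+1 = n%:R * x.
Proof.
case: n => [|n]; first by rewrite big_ord0 mul0r.
rewrite -[RHS]mulr1 -[X in _ = _ * X](sum_binomial_pmf n x) mulr_sumr.
apply: eq_bigr => s _.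
have binE : s.+1%:R * 'C(n.+1, s.+1)%:R = n.+1%:R * 'C(n, s)%:R :> K.
  by rewrite -!natrM -mul_bin_diag.
rewrite /binomial_pmf subSS exprS.
rewrite -[X in _ * X = _]mulr_natr -[X in _ = _ * X]mulr_natr.
rewrite [LHS]mulrCA binE; move: (x ^+ s) (_ ^+ (n - s)) => y z; ring.
Qed.

(** This is a(s), a lower bound on the probability of selecting a fixed optimal terminal given
    sample size s. *)
Definition sample_gain k n s : K := (\sum_(s <= t < n) survival K k s t) / n%:R.

Lemma sample_gain_ge0 k n s : 0 <= sample_gain k n s.
Proof. by rewrite divr_ge0 // sumr_ge0 // => t _; apply: survival_ge0. Qed.

(** Write A(s) for the sum of the survival products. Splitting off t = s, and the factor j = s+1
    from the other terms, gives (s+1) A(s) = (s+1) + (s+1-k) A(s+1). Equality is lost only because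
    the truncated [s.+1 - k] may exceed the real difference. *)
Lemma sample_gain_step k n s : (s < n)%N ->
  s.+1%:R * (sample_gain k n s.+1 - sample_gain k n s) <=
  k%:R * sample_gain k n s.+1 - s.+1%:R / n%:R.
Proof.
move=> ltsn; have n0 : (0 < n%:R :> K) by rewrite ltr0n (leq_ltn_trans _ ltsn).
have recS : s.+1%:R * (\sum_(s <= t < n) survival K k s t) =
    s.+1%:R + (s.+1 - k)%:R * (\sum_(s.+1 <= t < n) survival K k s.+1 t).
  rewrite big_ltn // mulrDr {1}/survival big_geq // mulr1; congr (_ + _).
  rewrite !mulr_sumr !big_nat; apply: eq_bigr => t /andP[ltst _].
  rewrite /survival big_ltn // mulrA; congr (_ * _).
  by rewrite mulrC divfK // pnatr_eq0.
set S := \sum_(s.+1 <= t < n) _ in recS *.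
have S0 : 0 <= S by apply: sumr_ge0 => t _; apply: survival_ge0.
rewrite /sample_gain -/S -mulrBl !mulrA -mulrBl.
rewrite ler_pM2r ?invr_gt0 // mulrBr recS.
have : (s.+1%:R - k%:R) * S <= (s.+1 - k)%:R * S.
  by apply: ler_wpM2r => //; rewrite lerBlDr -natrD ler_nat addnC -leq_subLR.
lra.
Qed.

Definition expected_gain k n x : K :=
  \sum_(s < n.+1) binomial_pmf n x s * sample_gain k n s.

(** Comparison with the differential equation: the expected gain g satisfies x g' <= k g - x and
    g(1) >= 0, where [h] has equalities, so [ge0_of_derive_le] applies to g - h. *)
Lemma expected_gain_ge k n p (h dh : K -> K) : (0 < n)%N -> 0 < p <= 1 ->
    (forall x, 0 < x -> is_derive x 1 h (dh x)) ->
    (forall x, 0 < x <= 1 -> x * dh x = k%:R * h x - x) ->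
  h 1 = 0 -> h p <= expected_gain k n p.
Proof.
move=> n0 p01 hD hE h1; rewrite -subr_ge0.
pose g : {poly K} := \sum_(s < n.+1) sample_gain k n s *: bernstein n s.
have gE x : g.[x] = expected_gain k n x.
  rewrite horner_sum; apply: eq_bigr => s _.
  by rewrite hornerZ horner_bernstein mulrC.
have pmf_ge0 x s : 0 < x <= 1 -> 0 <= binomial_pmf n x s.
  by move=> /andP[x0 x1]; rewrite binomial_pmf_ge0 // ltW.
have g0 x : 0 < x <= 1 -> 0 <= g.[x].
  move=> x01; rewrite gE; apply: sumr_ge0 => s _.
  by rewrite mulr_ge0 ?pmf_ge0 ?sample_gain_ge0.
rewrite -gE; apply: (@ge0_of_derive_le (fun x => g.[x] - h x)
  (fun x => g^`().[x] - dh x) k p p01) => [x x0|x x01|]; last first.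
- by rewrite h1 subr0 g0 // ltr01 lexx.
- rewrite !mulrBr hE // opprB addrCA [leRHS]addrC [leRHS]addrC.
  suff : x * g^`().[x] <= k%:R * g.[x] - x by lra.
  rewrite horner_deriv_bernstein_sum.
  apply: le_trans (_ : \sum_(s < n) (k%:R * sample_gain k n s.+1 -
     s.+1%:R / n%:R) * binomial_pmf n x s.+1 <= _).
    by apply: ler_sum => s _; rewrite ler_wpM2r ?pmf_ge0 // sample_gain_step.
  have -> : \sum_(s < n) (k%:R * sample_gain k n s.+1 -
      s.+1%:R / n%:R) * binomial_pmf n x s.+1 =
      k%:R * (\sum_(s < n) sample_gain k n s.+1 * binomial_pmf n x s.+1) -
      (\sum_(s < n) s.+1%:R * binomial_pmf n x s.+1) / n%:R.
    rewrite mulr_sumr mulr_suml -sumrB; apply: eq_bigr => s _.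
    by rewrite mulrBl mulrA [_ / _ * _]mulrAC.
  (* The mean of Bin(n,x) divided by n is x; what remains is g without its nonnegative term s =
     0. *)
  rewrite mean_binomial_pmf [_ / _]mulrAC divff ?pnatr_eq0 -?lt0n // mul1r.
  rewrite lerD2r ler_wpM2l //.
  rewrite gE /expected_gain big_ord_recl /= -[leLHS]add0r lerD //.
    by rewrite mulr_ge0 ?pmf_ge0 ?sample_gain_ge0.
  by apply: ler_sum => s _; rewrite mulrC.
- by apply: is_deriveB; exact: hD.
Qed.

End Analysis.

(** * Forbidden sets *)

Section ForbiddenSets.
Variables (K : realType) (V : finType) (R : {set V}).
Variables (I : pred {set V}) (gtR : rel V).

Lemma arrived_take (r : #|R|.-tuple V) (i : 'I_#|R|) :
  arrived r i = [set x in take i.+1 r].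
Proof.
apply/setP => x; rewrite inE; apply/imsetP/(nthP x) => [[j]|[j]].
  rewrite inE => leji ->; exists (nat_of_ord j).
    by rewrite size_take_min size_tuple leq_min ltnS leji ltn_ord.
  by rewrite nth_take // -tnth_nth.
rewrite size_take_min size_tuple leq_min => /andP[lji ljn].
rewrite nth_take // => <-; exists (Ordinal ljn); first by rewrite inE.
by rewrite (tnth_nth x).
Qed.

Lemma card_arrival_orders (P : pred (seq V)) :
  #|[set r in arrival_orders R | P r]| = nb_orders P R.
Proof.
rewrite cardE -(size_map (@tval _ _)) /nb_orders -size_filter.
apply: perm_size; apply: uniq_perm => [||w].
- by rewrite (map_inj_uniq val_inj) enum_uniq.
- by rewrite filter_uniq // permutations_uniq.
rewrite mem_filter mem_permutations; apply/mapP/andP => [[r]|[Pw wR]].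
  by rewrite mem_enum !inE => /andP[rR Pr] ->.
have size_w : size w == #|R| by rewrite (perm_enum_size wR).
by exists (Tuple size_w); rewrite // mem_enum !inE wR.
Qed.

Hypothesis matI : is_matroid R I.
Hypothesis ordR : strict_total_order_on R gtR.

Variables (k : nat) (p : K) (A : secretary_alg K R).
Hypothesis forbA : has_forbidden_sets I gtR k p A.

(** With [F X Y e] in the role of [b X Y], the forbidden-sets property says that every unobstructed
    order selects [e]. *)
Lemma count_selected_ge e s : e \in OPT I gtR R ->
  (#|R|.-1)`!%:R * (\sum_(s <= t < #|R|) survival K k s t) <=
    (#|[set r in arrival_orders R | e \in run A s r]|)%:R :> K.
Proof.
case: forbA => _ _ [F [F_small F_sel]] Re.
have eR : e \in R by apply: subsetP (OPT_sub _ _ _) _ Re.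
apply: le_trans (nb_orders_unobstructed (b := fun X Y => F X Y e) _ s eR _) _.
  move=> X Z Ze ZR XZ; apply: (F_small X Z e ZR _ XZ).2.
  (* The size bound on [F] asks for [e] to be optimal in [Z], which it inherits from [R]. *)
  exact: (OPT_restrict matI ordR ZR (subxx R) Ze Re).
rewrite -card_arrival_orders ler_nat; apply/subset_leq_card/subsetP => r.
rewrite !inE => /andP[rR]; rewrite rR /= => /andP[/andP[lesi]].
set i := index e r => ltir /allP avoid_r.
have ltin : (i < #|R|)%N by rewrite size_tuple in ltir.
pose t := Ordinal ltin.
have et : tnth r t = e by rewrite (tnth_nth e) nth_index // -index_mem.
have arrR j : arrived r j \subset R.
  apply/subsetP => x; rewrite arrived_take inE => /mem_take.
  by case/perm_enumP: rR => _ ->.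
rewrite -et; apply: F_sel; rewrite ?inE // et.
  apply: (OPT_restrict matI ordR (arrR t) (subxx R) _ Re).
  by rewrite -et; apply/imsetP; exists t; rewrite ?inE.
move=> j /andP[lesj ltji]; rewrite !arrived_take.
have ltji' : (j < i)%N by [].
have := avoid_r j; rewrite mem_index_iota lesj.
rewrite size_takel ?ltji; last exact: ltnW.
rewrite nth_take // -tnth_nth take_takel //; exact.
Qed.

(** The binomial law makes the probability a finite mixture over s. Exchanging the sums leaves
    [count_selected_ge] for each s, and n! = n (n-1)! supplies the factor 1/n. *)
Lemma prob_selected_ge e : 0 <= p <= 1 -> e \in OPT I gtR R ->
  \sum_(s < #|R|.+1) binomial_pmf #|R| p s *
     ((\sum_(s <= t < #|R|) survival K k s t) / #|R|%:R) <= prob_selected A e.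
Proof.
move=> p01 Re; case: (forbA) => _ [lawA _] _.
have fine_law r : fine (sample_law A [set s | e \in run A s r]%classic) =
    \sum_(s < #|R|.+1) binomial_pmf #|R| p s * (e \in run A s r)%:R.
  have /andP[p0 p1] := p01; rewrite lawA (binomial_probE (p0 := p0) #|R| p1).
  rewrite (eq_bigr (fun s : 'I_#|R|.+1 =>
    (binomial_pmf #|R| p s * (e \in run A s r)%:R)%:E)).
    by rewrite sumEFin.
  move=> s _; rewrite EFinM diracE; congr (_ * (_%:R)%:E)%E.
  by congr nat_of_bool; apply/idP/idP; rewrite classical_sets.in_setE.
have n_gt0 : (0 < #|R|)%N.
  by apply/card_gt0P; exists e; apply: subsetP (OPT_sub _ _ _) _ Re.
have card_orders : #|arrival_orders R| = (#|R|)`!.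
  have := card_arrival_orders predT.
  rewrite /nb_orders count_predT size_permutations ?enum_uniq // -cardE => <-.
  by apply: eq_card => r; rewrite !inE andbT.
rewrite /prob_selected card_orders (eq_bigr _ (fun r _ => fine_law r)).
rewrite exchange_big /= mulr_suml; apply: ler_sum => s _.
rewrite -mulr_sumr -mulrA; apply: ler_wpM2l; first exact: binomial_pmf_ge0.
have -> : \sum_(r in arrival_orders R) (e \in run A s r)%:R =
    (#|[set r in arrival_orders R | e \in run A s r]|)%:R :> K.
  rewrite -natr_sum -sum1dep_card big_mkcondr; congr (_%:R).
have := count_selected_ge s Re; set S := \sum_(_ <= _ < _) _ => leS.
have -> : (#|R|)`! = (#|R| * (#|R|.-1)`!)%N.
  by rewrite -[in LHS](prednK n_gt0) factS prednK.
rewrite natrM invfM [X in _ <= X]mulrC -mulrA.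
rewrite [X in X <= _]mulrC ler_wpM2l ?invr_ge0 ?ler0n //.
by rewrite ler_pdivlMl // ltr0n fact_gt0.
Qed.

End ForbiddenSets.

(** * The constants p(k) and alpha(k) *)

Section Constants.
Variable K : realType.

(** Serves the case k = 0, where [p_of] is 0: the sample is empty with probability 1, and all
    survival products are 1. *)
Lemma expected_gain0 n : (0 < n)%N -> expected_gain (K := K) 0 n 0 = 1.
Proof.
move=> n0; rewrite /expected_gain big_ord_recl big1 ?addr0 => [|s _].
  rewrite /binomial_pmf /= expr0 subn0 bin0 mulr1n mul1r /unstable.onem subr0.
  rewrite expr1n mul1r /sample_gain big_mkord.
  rewrite (eq_bigr (fun=> 1)) ?sumr_const ?card_ord => [|t _].
    by rewrite divff // pnatr_eq0 -lt0n.
  by rewrite /survival big1 // => j _; rewrite subn0 divff // pnatr_eq0.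
by rewrite /binomial_pmf expr0n /= mul0r mul0rn mul0r.
Qed.

(** The function -x ln x solves x h' = h - x and vanishes at 1. *)
Lemma expected_gain1_ge n (p : K) : (0 < n)%N -> 0 < p <= 1 ->
  - (p * ln p) <= expected_gain 1 n p.
Proof.
move=> n0 p01.
apply: (expected_gain_ge (h := fun x => - (x * ln x))
  (dh := fun x => - (x * x^-1 + ln x * 1)) n0 p01).
- move=> x x0; have lnD := is_derive1_ln x0.
  by apply: is_deriveN; apply: is_deriveM.
- move=> x /andP[x0 _]; rewrite divff ?gt_eqF //; ring.
- by rewrite ln1 mulr0 oppr0.
Qed.

(** For size k+2, the polynomial (x - x^(k+2)) / (k+1) solves x h' = (k+2) h - x and vanishes at
    1. *)
Lemma expected_gain_poly_ge k n (p : K) : (0 < n)%N -> 0 < p <= 1 ->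
  (p - p ^+ k.+2) / k.+1%:R <= expected_gain k.+2 n p.
Proof.
move=> n0 p01; pose q : {poly K} := k.+1%:R^-1 *: ('X - 'X^(k.+2)).
have qE x : q.[x] = (x - x ^+ k.+2) / k.+1%:R.
  by rewrite hornerZ mulrC hornerD hornerN hornerX hornerXn.
rewrite -qE.
apply: (expected_gain_ge (h := horner q) (dh := horner q^`()) n0 p01).
- move=> x _; rewrite qE derivZ derivB derivX derivXn hornerZ hornerD hornerN.
  rewrite hornerMn hornerXn hornerC -mulr_natl exprS -!natr1.
  by field; rewrite natr1 pnatr_eq0.
- by rewrite qE expr1n subrr mul0r.
Qed.

Lemma p_of_unit k : 0 <= p_of K k <= 1.
Proof.
rewrite /p_of; case: eqP => [_|_].
  by rewrite invr_ge0 expR_ge0 invf_le1 ?expR_gt0 // ltW // expR_gt1.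
rewrite powR_ge0 /=; case: k => [|[|k]].
(* At [k = 0] the exponent -1/(0-1) is 1, so the power is 0. *)
- by rewrite sub0r powR0 ?ler01 // invrN invr1 mulrN mulr1 opprK oner_neq0.
- by rewrite powR1 lexx.
rewrite -[leRHS](powRr0 k.+2%:R) ler_powR ?ler1n // oppr_le0 divr_ge0 //.
Qed.

(** Evaluate the lower bounds at p = [p_of]. For k = 1, -p ln p = 1/e at p = 1/e. For k >= 2,
    p^(k-1) = 1/k turns (p - p^k)/(k-1) into p/k, the inverse of [alpha_of]. For k = 0 both sides
    are 1. *)
Lemma alpha_of_le_expected_gain k n : (0 < n)%N ->
  (alpha_of K k)^-1 <= expected_gain k n (p_of K k).
Proof.
case: k => [|[|k]] n0.
- rewrite /alpha_of /p_of /= mul0r powRr0 invr1 sub0r powR0.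
    by rewrite expected_gain0.
  by rewrite invrN invr1 mulrN mulr1 opprK oner_neq0.
- have := p_of_unit 1; rewrite /alpha_of /p_of /= => /andP[_ p1].
  have p0 : 0 < (expR 1)^-1 :> K by rewrite invr_gt0 expR_gt0.
  apply: le_trans (expected_gain1_ge n0 _); last by rewrite p0 p1.
  by rewrite lnV ?posrE ?expR_gt0 // expRK mulrN opprK mulr1.
have /andP[_] := p_of_unit k.+2; rewrite /alpha_of /p_of /=.
have -> : k.+2%:R - 1 = k.+1%:R :> K by rewrite -natr1 addrK.
set p := _ `^ _ => p1.
have k0 : (0 < k.+2%:R :> K) by rewrite ltr0n.
have k1 : k.+1%:R != 0 :> K by rewrite pnatr_eq0.
have p0 : 0 < p by rewrite powR_gt0.
have pX : p ^+ k.+1 = k.+2%:R^-1.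
  rewrite -powR_mulrn ?(ltW p0) // -powRrM mulNr mul1r mulVf ?pnatr_eq0 //.
  by rewrite powR_inv1 // ltW.
have -> : (k.+2%:R `^ (k.+2%:R / k.+1%:R))^-1 = p * k.+2%:R^-1.
  rewrite -powRN -(powR_inv1 (ltW k0)) /p.
  rewrite -powRD ?(gt_eqF k0) ?implybT //; congr (_ `^ _).
  by rewrite -[in LHS](natr1 k.+1); field.
apply: le_trans (expected_gain_poly_ge k n0 _); last by rewrite p0 p1.
rewrite exprS pX le_eqVlt; apply/orP; left; apply/eqP.
by rewrite -(natr1 k.+1); field; rewrite nat1r natr1 !pnatr_eq0.
Qed.

End Constants.

(** * The packing algorithm *)

Section PackingAlgorithm.
Variables (HH : seq sgraph) (G : sgraph) (T : {set G}) (gtR : rel G).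
Variable Qc : {set G} -> {set subgraph_data G}.
Hypothesis matHH : matroidal HH.
Hypothesis ordT : strict_total_order_on T gtR.
Hypothesis canQc : canonical_packings HH T Qc.

Local Notation I := (packing_indep HH T).
Local Notation OPT := (OPT I gtR).

(** Being covered by a packing does not involve [T], so this system is the restriction to [T] of the
    matroid on all vertices. *)
Lemma packing_indep_matroid : is_matroid T I.
Proof.
have [_ ind0 hered aug] := matHH G.
have IE X : I X = (X \subset T) && packing_indep HH [set: G] X.
  by rewrite /packing_indep subsetT.
split=> [X|||]; rewrite ?IE.
- by case/andP.
- by rewrite sub0set.
- move=> X Y XY; rewrite !IE => /andP[YT IY].
  by rewrite (subset_trans XY YT) (hered X Y).
move=> X Y; rewrite !IE => /andP[XT IX] /andP[YT IY].
case/(aug _ _ IX IY) => y yYX IyX.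
exists y => //; rewrite IE IyX andbT subUset XT sub1set andbT.
by apply: (subsetP YT); case/setDP: yYX.
Qed.

Lemma packing_sub (P P' : {set subgraph_data G}) :
  P \subset P' -> is_packing HH P' -> is_packing HH P.
Proof.
move=> /subsetP PP' /andP[/forall_inP copyP' /forall_inP disjP'].
apply/andP; split; apply/forall_inP => S /PP' P'S; first exact: copyP'.
by apply/forall_inP => S' /PP'; apply: (forall_inP (disjP' S P'S)).
Qed.

Lemma graph_coveringP (P : {set subgraph_data G}) v C :
  graph_covering P v = Some C -> C \in P /\ v \in C.1.
Proof. by rewrite /graph_covering; case: pickP => // S /andP[PS Sv] [<-]. Qed.

Lemma graph_covering_canonical X v : I X -> v \in X ->
  exists C, [/\ graph_covering (Qc X) v = Some C, C \in Qc X, v \in C.1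
              & is_copy HH C].
Proof.
move=> IX Xv; have /andP[packX /subsetP/(_ v Xv)] := canQc IX.
case/bigcupP => S QS Sv; case E : (graph_covering (Qc X) v) => [C|].
  have [QC Cv] := graph_coveringP E; exists C; split=> //.
  by case/andP: packX => /forall_inP/(_ C QC).
by move: E; rewrite /graph_covering; case: pickP => // /(_ S); rewrite QS Sv.
Qed.

(* The graph covering x is left out: the remaining ones form a packing that does
   not cover x, as exchangeability requires, and once the algorithm has used a
   graph covering x it accepts x anyway. *)
Definition forbidden_graphs (X : {set G}) (x : G) (C : subgraph_data G) :=
  [set S in Qc (OPT X) | (x \notin S.1) && ~~ [disjoint C.1 & S.1]].

(** If the last arrival of [X] avoids this set, its graph in the canonical packing of [OPT X] either
    covers [x] or is disjoint from [C]. The default [set0] is not reached when [x] is in [OPT Y]. *)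
Definition forbidden_set (X Y : {set G}) (x : G) : {set G} :=
  if graph_covering (Qc (OPT Y)) x is Some C then
    X :&: (\bigcup_(S in forbidden_graphs X x C) (S.1 :&: T))
  else set0.

Lemma card_forbidden_set (X Y : {set G}) x :
    Y \subset T -> x \in OPT Y ->
  (#|forbidden_set X Y x| <= exchangeability HH T)%N.
Proof.
have matI := packing_indep_matroid => YT Yx.
have Tx : x \in T by apply/(subsetP YT)/(subsetP (OPT_sub _ _ _) _ Yx).
have [C [EC QC Cx copyC]] := graph_covering_canonical (OPT_indep matI gtR Y) Yx.
rewrite /forbidden_set EC; set P := [set S in Qc (OPT X) | x \notin S.1].
have packP : is_packing HH P.
  have /andP[packX _] := canQc (OPT_indep matI gtR X).
  by apply: packing_sub packX; apply/subsetP => S; rewrite inE => /andP[].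
have nPx : x \notin covered P.
  by apply/bigcupP => -[S]; rewrite inE => /andP[_ /negP].
apply: leq_trans (subset_leq_card (subsetIr _ _)) _.
apply: leq_trans (_ : \sum_(S in forbidden_graphs X x C) #|S.1 :&: T| <= _)%N.
  elim/big_rec2: _ => [|S m B _ leBm]; first by rewrite cards0.
  exact: leq_trans (leq_card_setU _ _) (leq_add _ _).
(* This pair competes in the maximum defining [exchangeability]: [C] covers the terminal [x], which
   [P] misses. *)
pose PS : {set subgraph_data G} * subgraph_data G := (P, C).
rewrite /exchangeability; apply: leq_trans (leq_bigmax_cond PS _).
  rewrite (eq_bigl (fun S => (S \in P) && ~~ [disjoint C.1 & S.1])) //= => S.
  by rewrite !inE andbA.
by rewrite packP copyC; apply/exists_inP; exists x; rewrite // Cx.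
Qed.

Section Run.
Variable r : #|T|.-tuple G.
Hypothesis rT : r \in arrival_orders T.

Lemma arrival_uniq : injective (tnth r).
Proof.
by apply/tuple_uniqP; move: rT; rewrite inE => /perm_uniq->; apply: enum_uniq.
Qed.

Lemma arrived_sub i : arrived r i \subset T.
Proof.
apply/subsetP => x; rewrite arrived_take inE => /mem_take.
by move: rT; rewrite inE => /perm_mem->; rewrite mem_enum.
Qed.

Lemma arrived_self i : tnth r i \in arrived r i.
Proof. by apply/imsetP; exists i; rewrite ?inE. Qed.

Implicit Type st : {set G} * {set subgraph_data G}.

(** The third clause traces each graph in use to a processed terminal, to which a later conflict can
    be charged. The fourth keeps sampled terminals out of the output. *)
Definition run_invariant (l : seq 'I_#|T|) st : Prop :=
  [/\ is_packing HH st.2, st.1 \subset covered st.2,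
      forall C, C \in st.2 -> exists2 j, j \in l &
        graph_covering (Qc (OPT (arrived r j))) (tnth r j) = Some C
    & forall x, x \in st.1 -> exists2 j, j \in l & x = tnth r j].

Lemma step_invariant l st i : run_invariant l st ->
  run_invariant (rcons l i) (packing_step HH gtR Qc r st i).
Proof.
case: st => A Q [/= packQ AQ QC Al]; rewrite /packing_step /=.
have Al' x : x \in A -> exists2 j, j \in rcons l i & x = tnth r j.
  by case/Al => j lj ->; exists j; rewrite // mem_rcons in_cons lj orbT.
have QC' C : C \in Q -> exists2 j, j \in rcons l i &
    graph_covering (Qc (OPT (arrived r j))) (tnth r j) = Some C.
  by case/QC => j lj Ej; exists j; rewrite // mem_rcons in_cons lj orbT.
have add_x x : x \in tnth r i |: A -> exists2 j, j \in rcons l i & x = tnth r j.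
  by case/setU1P => [->|/Al'//]; exists i; rewrite // mem_rcons mem_head.
have unchanged : run_invariant (rcons l i) (A, Q) by split.
case: ifP => // _; case: ifP => [Qx|_].
  by split=> //=; rewrite subUset sub1set Qx.
case EC: graph_covering => [C|//]; case: ifP => // packCQ.
have [_ Cx] := graph_coveringP EC.
split=> //= [|S].
  apply/subsetP => x /setU1P[->|/(subsetP AQ)/bigcupP[S QS Sx]]; apply/bigcupP.
    by exists C; rewrite ?setU11.
  by exists S; rewrite // setU1r.
by case/setU1P => [->|/QC'//]; exists i; rewrite // mem_rcons mem_head.
Qed.

Lemma run_invariant_foldl l :
  run_invariant l (foldl (packing_step HH gtR Qc r) (set0, set0) l).
Proof.
elim/last_ind: l => [|l i IHl]; last first.
  by rewrite foldl_rcons; apply: step_invariant.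
split=> /= [||C|x]; rewrite ?sub0set ?inE //.
by apply/andP; split; apply/forall_inP => S; rewrite inE.
Qed.

Lemma step_mono st i : st.1 \subset (packing_step HH gtR Qc r st i).1.
Proof.
case: st => A Q; rewrite /packing_step; case: ifP => // _.
case: ifP => _; first exact: subsetUr.
by case: graph_covering => [C|//]; case: ifP => // _; apply: subsetUr.
Qed.

Lemma foldl_mono st l : st.1 \subset (foldl (packing_step HH gtR Qc r) st l).1.
Proof.
elim: l st => //= i l IHl st.
exact: subset_trans (step_mono st i) (IHl _).
Qed.

(** If the terminal is not yet covered, a graph in use that meets its canonical graph [C] cannot
    cover it, and was brought in by a processed terminal. That terminal would then lie in the
    forbidden set. *)
Lemma step_selects l st i : run_invariant l st ->
    tnth r i \in OPT (arrived r i) ->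
    (forall j, j \in l ->
      tnth r j \notin forbidden_set (arrived r j) (arrived r i) (tnth r i)) ->
  tnth r i \in (packing_step HH gtR Qc r st i).1.
Proof.
case: st => A Q [/= packQ AQ QC _] Ox avoid; rewrite /packing_step Ox.
case: ifPn => [_|nQx]; first by rewrite setU11.
have matI := packing_indep_matroid.
have [C [EC QcC Cx copyC]] :=
  graph_covering_canonical (OPT_indep matI gtR _) Ox.
rewrite EC.
have disjC S : S \in Q -> [disjoint C.1 & S.1].
  move=> QS; apply/negPn/negP => meetC; have [j lj ES] := QC S QS.
  have [QcS Sj] := graph_coveringP ES.
  case/negP: (avoid j lj); rewrite /forbidden_set EC inE arrived_self /=.
  apply/bigcupP; exists S.
    rewrite inE QcS meetC andbT /=; apply: contra nQx => Sx.
    by apply/bigcupP; exists S.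
  by rewrite inE Sj (subsetP (arrived_sub j)) // arrived_self.
suff -> : is_packing HH (C |: Q) by rewrite setU11.
case/andP: packQ => /forall_inP copyQ /forall_inP disjQ.
apply/andP; split; apply/forall_inP => S.
  by case/setU1P => [->//|/copyQ].
case/setU1P => [->|QS]; apply/forall_inP => S'; case/setU1P => [->|QS'].
- by rewrite eqxx.
- by apply/implyP => _; apply: disjC.
- by apply/implyP => _; rewrite disjoint_sym disjC.
- exact: (forall_inP (disjQ S QS)).
Qed.

End Run.

Local Notation unsampled s := [seq i : 'I_#|T| <- enum 'I_#|T| | (s <= i)%N].

Lemma packing_alg_forbidden_sets (K : realType) (p : K) :
  has_forbidden_sets I gtR (exchangeability HH T) p (packing_alg HH T gtR Qc p).
Proof.
have matI := packing_indep_matroid.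
split=> [s r _ rT|/=|].
- have [packQ AQ _ Al] := run_invariant_foldl r (unsampled s).
  rewrite /packing_indep; apply/andP; split.
    2: by apply/existsP; eexists; apply/andP; split; [exact: packQ|exact: AQ].
  apply/subsetP => x /Al[j _ ->].
  exact: subsetP (arrived_sub rT j) _ (arrived_self r j).
- split=> // s r i _ rT ltis; apply/negP => /=.
  have [_ _ _ Al] := run_invariant_foldl r (unsampled s).
  case/Al => j; rewrite mem_filter => /andP[lesj _] /(arrival_uniq rT) eij.
  by rewrite -eij leqNgt ltis in lesj.
exists forbidden_set; split=> [X Y x YT Yx XY|s r t rT lest Ox avoid].
  split; last exact: card_forbidden_set.
  rewrite /forbidden_set.
  by case: graph_covering => [C|]; rewrite ?subsetIl ?sub0set.
rewrite /= /packing_run.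
have : t \in (unsampled s) by rewrite mem_filter lest mem_enum.
have : pairwise (fun i j : 'I_#|T| => (i < j)%N) (unsampled s).
  apply: pairwise_filter; rewrite -(pairwise_map val ltn) val_enum_ord.
  by rewrite -sorted_pairwise ?iota_ltn_sorted //; apply: ltn_trans.
have : all (fun i : 'I__ => (s <= i)%N) (unsampled s).
  exact: filter_all.
(* Cut the processed indices at [t]: those before it lie in [s, t), where [avoid] applies, and those
   after it cannot undo the selection. *)
move: (unsampled s) => l /[swap] + /[swap] tl; case/splitPr: tl => l1 l2.
rewrite pairwise_cat all_cat allrel_consr => /and3P[/andP[/allP lt_t _] _ _].
case/andP => /allP ge_s _.
rewrite foldl_cat /=; apply: (subsetP (foldl_mono r _ l2)).
apply: (step_selects rT (run_invariant_foldl r l1)) => // j l1j.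
by apply: avoid; rewrite ge_s ?lt_t.
Qed.

End PackingAlgorithm.

Theorem theorem5 (K : realType) (HH : seq sgraph) (G : sgraph) (T : {set G})
    (gtR : rel G) (Qc : {set G} -> {set subgraph_data G}) :
  matroidal HH ->
  strict_total_order_on T gtR ->
  canonical_packings HH T Qc ->
  (forall p : K, 0 <= p <= 1 ->
     has_forbidden_sets (packing_indep HH T) gtR (exchangeability HH T) p
       (packing_alg HH T gtR Qc p)) /\
  probability_competitive (packing_indep HH T) gtR
    (alpha_of K (exchangeability HH T))
    (packing_alg HH T gtR Qc (p_of K (exchangeability HH T))).
Proof.
move=> matHH ordT canQc.
have matI := packing_indep_matroid T matHH.
have forb (p : K) : has_forbidden_sets (packing_indep HH T) gtR
    (exchangeability HH T) p (packing_alg HH T gtR Qc p).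
  exact: packing_alg_forbidden_sets.
split=> [p _ //|e Te].
have T0 : (0 < #|T|)%N.
  by apply/card_gt0P; exists e; apply: subsetP (OPT_sub _ _ _) _ Te.
(* The two bounds meet in [expected_gain], which is the left side of [prob_selected_ge] up to
   unfolding. *)
apply: le_trans (alpha_of_le_expected_gain K _ T0) _.
exact: (prob_selected_ge matI ordT (forb _) (p_of_unit K _) Te).
Qed.
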